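(* Let $\{G_n\}$ be a Gibonacci sequence. For all positive integers $n$ and all positive integers $N\le n$, $$G_NG_{n-N}+G_{N-1}G_{n-N-1}=G_1G_{n-1}+G_0G_{n-2}.$$
   Context: A Gibonacci sequence is a sequence satisfying $G_n=G_{n-1}+G_{n-2}$, with initial values $G_0,G_1$ chosen freely (here arbitrary integers). The sequence is extended to negative indices by the same recurrence, so that $G_{-1}=G_1-G_0$. *)

(* Defs.v *)
From mathcomp Require Import all_boot all_order all_algebra.

Set Implicit Arguments.
Unset Strict Implicit.
Unset Printing Implicit Defensive.

Import Order.TTheory GRing.Theory Num.Theory.
Local Open Scope ring_scope.

(* Two-sided: the recurrence holds at every integer index, so the values at
   negative indices are determined by G 0 and G 1; e.g. G (-1) = G 1 - G 0. *)
Definition gibonacci (G : int -> int) : Prop :=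
  forall m : int, G m = G (m - 1) + G (m - 2).

(* Main.v *)
Require Import Defs.
From mathcomp Require Import all_boot all_order all_algebra.
From mathcomp Require Import ring zify.

(** For a fixed sum of the indices a and b, the quantity
    [G (a + 1) * G (b + 1) + G a * G b] does not depend on how the sum is
    split: moving one unit from b to a leaves it unchanged
    ([gibonacci_transfer]), because expanding the largest index by the
    recurrence on either side gives the same three products.  With
    [a + b = n - 2], both sides of the theorem are values of this quantity,
    at [a = N - 1] and at [a = 0], so iterating the transfer N - 1 times
    ([gibonacci_convolution]) joins them. *)

Set Implicit Arguments.
Unset Strict Implicit.
Unset Printing Implicit Defensive.

Import Order.TTheory GRing.Theory Num.Theory.
Local Open Scope ring_scope.

Lemma gibonacciD2 (G : int -> int) (hG : gibonacci G) (m : int) :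
  G (m + 2) = G (m + 1) + G m.
Proof.
by rewrite hG; congr (G _ + G _); ring.
Qed.

(** Both sides equal
    [G (a + 1) * G (b + 1) + G a * G (b + 1) + G (a + 1) * G b]. *)
Lemma gibonacci_transfer (G : int -> int) (hG : gibonacci G) (a b : int) :
  G (a + 2) * G (b + 1) + G (a + 1) * G b =
  G (a + 1) * G (b + 2) + G a * G (b + 1).
Proof.
by rewrite !(gibonacciD2 hG); ring.
Qed.

(** Leaving b free lets the induction on k apply its hypothesis at b + 1. *)
Lemma gibonacci_convolution (G : int -> int) (hG : gibonacci G) (k : nat)
    (b : int) :
  G (k%:Z + 1) * G (b + 1) + G k%:Z * G b =
  G 1 * G (b + k%:Z + 1) + G 0 * G (b + k%:Z).
Proof.
elim: k b => [|k IHk] b; first by rewrite add0r addr0.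
have -> : k.+1%:Z + 1 = k%:Z + 2 by lia.
have -> : k.+1%:Z = k%:Z + 1 by lia.
have -> : b + (k%:Z + 1) = b + 1 + k%:Z by ring.
rewrite (gibonacci_transfer hG) -IHk.
by have -> : b + 1 + 1 = b + 2 by ring.
Qed.

Theorem mainTheorem1 (G : int -> int) (hG : gibonacci G) (n N : int)
    (hn : 0 < n) (hN : 0 < N) (hNn : N <= n) :
  G N * G (n - N) + G (N - 1) * G (n - N - 1) =
  G 1 * G (n - 1) + G 0 * G (n - 2).
Proof.
have [k defN] : exists k : nat, N = k%:Z + 1 by exists `|N - 1|%N; lia.
have -> : n - 1 = n - N - 1 + k%:Z + 1 by lia.
have -> : n - 2 = n - N - 1 + k%:Z by lia.
rewrite -(gibonacci_convolution hG).
by congr (G _ * G _ + G _ * G _); lia.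
Qed.
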